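(* Let $A$ be a preorder, regarded as a category enriched over $\mathbf{Bool}$. Via $M\mapsto \{x\in A\mid M(x)=1\}$: (a) $Flat_{\mathcal{P}_1}(A)$, as a preorder, is isomorphic to the set of non-empty downsets of $A$ ordered by inclusion; (b) $Flat_{\mathcal{P}_2}(A)$, as a preorder, is isomorphic to the algebraic (ideal) completion $Alg(A)$ of $A$, i.e. the set of non-empty directed downsets of $A$ ordered by inclusion.
   Context: $\mathbf{Bool}$ is the poset $\{0<1\}$ with tensor $\wedge$, unit $1$ and internal hom $\Rightarrow$; categories enriched over it are preorders ($x\to y$ iff $A(x,y)=1$). A presheaf (left module) $M:A^{op}\to\mathbf{Bool}$ is an order-reversing map on $A$; functors $A\to\mathbf{Bool}$ (right modules) are order-preserving maps. Presheaves are ordered pointwise. For a class $\mathcal{P}$ of order-preserving maps $F:K\to\mathbf{Bool}$ on preorders $K$ (indexes), $M$ is $\mathcal{P}$-flat if $-*M: N\mapsto\bigvee_{x\in A}(M(x)\wedge N(x))$ on right modules preserves all limits with index in $\mathcal{P}$; explicitly: for every $F:K\to\mathbf{Bool}$ in $\mathcal{P}$ and every family $(L_k)_{k\in K}$ of right modules, order-preserving in $k$, $$\bigvee_{x\in A}\Big(M(x)\wedge\bigwedge_{k\in K}(F(k)\Rightarrow L_k(x))\Big)=\bigwedge_{k\in K}\Big(F(k)\Rightarrow\bigvee_{x\in A}(M(x)\wedge L_k(x))\Big).$$ $\mathcal{P}_1$ consists of the indexes with $K$ empty or a single point; $\mathcal{P}_2$ of those with $K$ finite. $Flat_{\mathcal{P}}(A)$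 is the set of $\mathcal{P}$-flat presheaves with the pointwise order. A downset is a downward closed subset; it is directed if every finite family of its elements has an upper bound in it. *)

(* Defs.v *)
From HB Require Import structures.
From mathcomp Require Import all_boot all_order.
From mathcomp Require Import boolp classical_sets functions cardinality.
Set Implicit Arguments.
Unset Strict Implicit.
Unset Printing Implicit Defensive.
Import Order.TTheory.
Local Open Scope order_scope.
Local Open Scope classical_set_scope.

(* [Bool] is [bool] with its library order (false < true): the tensor is [&&],
   the internal hom is [==>], and joins and meets of arbitrary families are
   [`[< exists x, _ >]] and [`[< forall x, _ >]]. *)

Section PointwiseOrder.
Context (d d' : Order.disp_t) (T : preorderType d) (T' : preorderType d').
Implicit Types f g h : {omorphism T -> T'}.

HB.instance Definition _ := gen_eqMixin {omorphism T -> T'}.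
HB.instance Definition _ := gen_choiceMixin {omorphism T -> T'}.

Definition pointwise_le f g : bool := `[< forall x, f x <= g x >].

Lemma pointwise_le_refl : reflexive pointwise_le.
Proof. by move=> f; apply/asboolP. Qed.

Lemma pointwise_le_trans : transitive pointwise_le.
Proof.
move=> g f h /asboolP fg /asboolP gh; apply/asboolP => x.
exact: le_trans (fg x) (gh x).
Qed.

HB.instance Definition _ := @Order.Le_isPreorder.Build d' {omorphism T -> T'}
  pointwise_le pointwise_le_refl pointwise_le_trans.
End PointwiseOrder.

Notation presheaf A := {omorphism A^d -> bool}.
Notation rmodule A := {omorphism A -> bool}.

Definition tensor d (A : preorderType d) (N : rmodule A) (M : presheaf A)
  : bool := `[< exists x : A, M x && N x >].

(* The [Bool]-enriched limits weighted by [F], in [Bool] and (pointwise) in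
   right modules. *)
Section WeightedLimit.
Context (dK : Order.disp_t) (K : preorderType dK) (F : {omorphism K -> bool}).

Definition wlim_bool (b : K -> bool) : bool := `[< forall k, F k ==> b k >].

Context (d : Order.disp_t) (A : preorderType d).
Variable L : {omorphism K -> rmodule A}.

Definition wlim_fun (x : A) : bool := wlim_bool (fun k => L k x).

Lemma wlim_fun_homo : {homo wlim_fun : x y / x <= y}.
Proof.
move=> x y xy; case Lx: (wlim_fun x); last exact: le0x.
suff -> : wlim_fun y by [].
move: Lx => /asboolP Lx; apply/asboolP => k; move: (Lx k).
by have := omorph_le (L k) xy; case: (F k) (L k x) (L k y) => [] [] [].
Qed.

HB.instance Definition _ :=
  Order.isOrderMorphism.Build d A _ bool wlim_fun wlim_fun_homo.

Definition wlim : rmodule A := (wlim_fun : {omorphism A -> bool}).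
End WeightedLimit.

(* [P] below is a class of weights; [flat P M] says that [tensor - M] preserves
   their limits in the category of right modules. *)
Record windex := WIndex {
  index_disp : Order.disp_t;
  index_dom : preorderType index_disp;
  index_weight : {omorphism index_dom -> bool} }.

Definition flat (P : windex -> Prop) d (A : preorderType d) (M : presheaf A) : Prop :=
  forall i : windex, P i -> forall L : {omorphism index_dom i -> rmodule A},
    tensor (wlim (index_weight i) L) M =
    wlim_bool (index_weight i) (fun k => tensor (L k) M).

Definition P1 (i : windex) : Prop :=
  [set: index_dom i] = set0 \/ exists k, [set: index_dom i] = [set k].

Definition P2 (i : windex) : Prop := finite_set [set: index_dom i].

(* The preorder is induced along [val], hence pointwise. *)
Definition Flat (P : windex -> Prop) d (A : preorderType d) : Type :=
  {M : presheaf A | `[< flat P M >]}.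
HB.instance Definition _ P d (A : preorderType d) := SubChoice.on (Flat P A).
HB.instance Definition _ P d (A : preorderType d) :=
  [SubChoice_isSubPreorder of Flat P A by <: with Order.Disp tt tt].

Section Downsets.
Context (d : Order.disp_t) (A : preorderType d).
Implicit Types D S : set A.

Definition downset D : Prop := forall x y, x <= y -> D y -> D x.

Definition directed D : Prop := forall S, finite_set S -> S `<=` D ->
  exists2 y, D y & forall x, S x -> x <= y.

(* The preorder is induced along [val] by the library's order on [set A],
   which is inclusion. *)
Definition NonemptyDownset : Type :=
  {D : set A | `[< downset D /\ D !=set0 >]}.
HB.instance Definition _ := SubChoice.on NonemptyDownset.
HB.instance Definition _ :=
  [SubChoice_isSubPreorder of NonemptyDownset by <: with set_display].

Definition Alg : Type := {D : set A | `[< [/\ downset D, D !=set0 & directed D] >]}.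
HB.instance Definition _ := SubChoice.on Alg.
HB.instance Definition _ :=
  [SubChoice_isSubPreorder of Alg by <: with set_display].

End Downsets.

Definition preorder_iso d d' (T : preorderType d) (T' : preorderType d')
    (f : {omorphism T -> T'}) : Prop :=
  exists g : {omorphism T' -> T}, cancel f g /\ cancel g f.

(* Main.v *)
Require Import Defs.
From HB Require Import structures.
From mathcomp Require Import all_boot all_order.
From mathcomp Require Import boolp classical_sets functions cardinality.
Local Open Scope classical_set_scope.
Import Order.TTheory.

(** If [M] is flat for the limit indexed by a set [S] of points of [A] with the
    reversed order, weight 1, and the representables [L_k = A(k, -)], then the
    flatness equation says: when [M] contains [S], it contains an upper bound of
    [S].  With [S] empty this is non-emptiness, with [S] finite directedness.
    Conversely, one half of the equation always holds, and the other is obtained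
    by choosing a witness for each index and taking an upper bound of the
    witnesses in [M], since the [L_k] are upward closed. *)

Section OrderMorphisms.
Context {d d' : Order.disp_t} {T : preorderType d} {T' : preorderType d'}.

Definition mk_omorphism (f : T -> T') (fh : {homo f : x y / (x <= y)%O}) :
  {omorphism T -> T'} :=
  HB.pack f (Order.isOrderMorphism.Build d T d' T' f fh).

Lemma omorphism_ext (f g : {omorphism T -> T'}) : f =1 g -> f = g.
Proof.
case: f g => [f [[fh]]] [g [[gh]]] /= fg.
have {}fg : f = g by apply: funext.
by case: _ / fg gh => gh; rewrite (Prop_irrelevance fh gh).
Qed.

Lemma le_omorphismP (f g : {omorphism T -> T'}) :
  reflect (forall x, (f x <= g x)%O) (f <= g)%O.
Proof. exact: asboolP. Qed.

End OrderMorphisms.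

(** The order is reversed because [k |-> A(k, -)] is contravariant, while a family indexed by a
    weight must be order-preserving. *)
Definition subset_dual {d} {A : preorderType d} (S : set A) : Type :=
  {x : A^d | `[< S x >]}.
HB.instance Definition _ d (A : preorderType d) (S : set A) :=
  SubChoice.on (subset_dual S).
HB.instance Definition _ d (A : preorderType d) (S : set A) :=
  [SubChoice_isSubPreorder of subset_dual S by <: with Order.Disp tt tt].

Section Flatness.
Context {d : Order.disp_t} {A : preorderType d}.
Implicit Types (M : presheaf A) (S D : set A).

Definition points M : set A := [set x : A | M x = true].

Lemma downset_points M : downset (points M).
Proof.
move=> x y xy; rewrite /points /= => My.
have := omorph_le M xy.
by rewrite My; case: (M x).
Qed.

Lemma finite_subset_dual S :
  finite_set S -> finite_set [set: subset_dual S].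
Proof.
move=> fS; rewrite (_ : [set: _] = (val : subset_dual S -> A) @^-1` S).
  by apply: finite_preimage => // x y _ _; exact: val_inj.
by apply/seteqP; split=> // x _; apply/asboolP; exact: (valP x).
Qed.

Section UpperBound.
Variable S : set A.

Lemma weight_homo :
  {homo (fun _ : subset_dual S => true) : x y / (x <= y)%O}.
Proof. by []. Qed.

Definition upper_index : windex :=
  WIndex (mk_omorphism _ weight_homo).

Lemma representable_homo (k : A) :
  {homo (fun x : A => (k <= x)%O) : x y / (x <= y)%O}.
Proof.
move=> x y xy; case kx: (k <= x)%O => //.
by rewrite (le_trans kx xy).
Qed.

Definition representable (k : A) : rmodule A :=
  mk_omorphism _ (representable_homo k).

Lemma representable_dual_homo :
  {homo (fun k : subset_dual S => representable (val k)) : k l / (k <= l)%O}.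
Proof.
move=> k l kl; apply/le_omorphismP => x /=.
case kx: (_ <= x)%O => //.
by rewrite (le_trans (kl : (val l <= val k :> A)%O) kx).
Qed.

Lemma flat_upper_bound (P : windex -> Prop) M :
  P upper_index -> flat P M -> S `<=` points M ->
  exists2 y, points M y & forall x, S x -> (x <= y)%O.
Proof.
move=> PS /(_ _ PS (mk_omorphism _ representable_dual_homo)) MS SM.
have : tensor (wlim (index_weight upper_index)
         (mk_omorphism _ representable_dual_homo)) M.
  (* On the right-hand side each [k] is its own witness, by reflexivity. *)
  rewrite MS; apply/asboolP => k /=; apply/asboolP; exists (val k).
  by rewrite (SM _ (asboolW (valP k))) /=.
(* A point of the limit of the representables is exactly an upper bound of [S]. *)
case/asboolP => y /andP[My /asboolP uy]; exists y => // x Sx.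
by have := uy (exist _ (x : A^d) (asboolT Sx)).
Qed.

End UpperBound.

(** A single witness on the left serves all indexes at once, so this half needs no flatness. *)
Lemma tensor_wlim_le M (i : windex)
    (L : {omorphism index_dom i -> rmodule A}) :
  tensor (wlim (index_weight i) L) M ->
  wlim_bool (index_weight i) (fun k => tensor (L k) M).
Proof.
case/asboolP => x /andP[Mx /asboolP Lx]; apply/asboolP => k.
by apply/implyP => Fk; apply/asboolP; exists x; rewrite Mx (implyP (Lx k)).
Qed.

Lemma flat_criterion (P : windex -> Prop) M : points M !=set0 ->
  (forall i, P i -> forall w : index_dom i -> A, (forall k, points M (w k)) ->
     exists2 y, points M y & forall k, (w k <= y)%O) ->
  flat P M.
Proof.
move=> [x0 Mx0] ub i Pi L; apply/idP/idP; first exact: tensor_wlim_le.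
move=> /asboolP LM.
have /choice[w wP] (k : index_dom i) :
    exists x, M x /\ (index_weight i k -> L k x).
  (* Where the weight is 0 nothing is asked of [L k], but the witness must still lie in [M]: [x0] is
     the default. *)
  case Fk: (index_weight i k); last by exists x0.
  by have /asboolP[x /andP[Mx Lx]] := implyP (LM k) Fk; exists x.
have [y My wy] := ub i Pi w (fun k => (wP k).1).
apply/asboolP; exists y; rewrite My; apply/asboolP => k; apply/implyP => Fk.
by have := omorph_le (L k) (wy k); rewrite ((wP k).2 Fk); case: (L k y).
Qed.

Lemma flat_P1P M : flat P1 M <-> downset (points M) /\ points M !=set0.
Proof.
split=> [fM|[_ M0]].
  split; first exact: downset_points.
  (* With [S] empty the index is empty, hence in [P1], and any upper bound is just a point of
     [M]. *)
  have [||y My _] := @flat_upper_bound set0 _ _ _ fM; last by exists y.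
    by left; apply/seteqP; split=> // x _; exact: (asboolW (valP x)).
  by [].
apply: flat_criterion => // i [i0|[k ik]] w wM.
  (* For the empty index any point of [M] will do; for a one-point index the only witness bounds
     itself. *)
  have [y My] := M0; exists y => // k.
  by have : [set: index_dom i] k by []; rewrite i0.
exists (w k) => // l; have : [set: index_dom i] l by [].
by rewrite ik => ->.
Qed.

Lemma flat_P2P M :
  flat P2 M <-> [/\ downset (points M), points M !=set0 & directed (points M)].
Proof.
split=> [fM|[_ M0 dM]].
  have dM : directed (points M).
    by move=> S fS; apply: flat_upper_bound fM; exact: finite_subset_dual.
  split=> //; first exact: downset_points.
  by have [|y My _] := dM set0 (finite_set0 A); last exists y.
apply: flat_criterion => // i fi w wM.
(* The witnesses form a finite subset of [M], so directedness bounds them. *)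
have [|_ [k _ <-] //|y My wy] := dM (range w); first exact: finite_image.
by exists y => // k; apply: wy; exists k.
Qed.

Lemma indicator_homo D : downset D ->
  {homo (fun x : A^d => `[< D x >]) : x y / (x <= y)%O}.
Proof.
move=> dD x y xy; case: asboolP => // Dx.
by rewrite (asboolT (dD y x xy Dx)).
Qed.

Definition indicator {D} (dD : downset D) : presheaf A :=
  mk_omorphism _ (indicator_homo D dD).

Lemma points_indicator D (dD : downset D) : points (indicator dD) = D.
Proof. by apply/seteqP; split=> x /asboolP. Qed.

Lemma indicator_points M (dM : downset (points M)) : indicator dM = M.
Proof. by apply: omorphism_ext => x; exact: asboolb. Qed.

Lemma points_le M N : (points M <= points N)%O = (M <= N)%O.
Proof.
apply/subsetPset/le_omorphismP => [MN x|MN x].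
  by case Mx: (M x) => //; rewrite (MN x Mx).
by rewrite /points /= => Mx; have := MN x; rewrite Mx; case: (N x).
Qed.

(** Common to both parts of the theorem. That [Q] implies [downset] makes the indicator of each
    element of [T] a presheaf, and this gives the inverse map. *)
Lemma Flat_iso (P : windex -> Prop) (Q : set A -> Prop)
    (T : Order.SubPreorder.type (fun D : set A => `[< Q D >]) set_display) :
  (forall D, Q D -> downset D) -> (forall M, flat P M <-> Q (points M)) ->
  exists2 f : {omorphism Flat P A -> T},
    (forall M : Flat P A, val (f M) = points (val M)) & preorder_iso f.
Proof.
move=> Qd PQ.
have fQ (M : Flat P A) : `[< Q (points (val M)) >].
  by apply/asboolP/PQ/asboolP; exact: (valP M).
have dT (D : T) : downset (val D) by apply: Qd; exact: (asboolW (valP D)).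
have gP (D : T) : `[< flat P (indicator (dT D)) >].
  by apply/asboolP/PQ; rewrite points_indicator; exact: (asboolW (valP D)).
pose f (M : Flat P A) : T := Sub (points (val M)) (fQ M).
pose g (D : T) : Flat P A := exist _ (indicator (dT D)) (gP D).
(* Both orders are induced along [val], so monotonicity of [f] and [g] reduces to [points_le]. *)
have fh : {homo f : M N / (M <= N)%O}.
  by move=> M N MN; rewrite leEsub !SubK points_le -leEsub.
have gh : {homo g : D E / (D <= E)%O}.
  by move=> D E DE; rewrite leEsub -points_le !points_indicator -leEsub.
exists (mk_omorphism f fh) => [M|]; first exact: SubK.
exists (mk_omorphism g gh); split=> x; apply: val_inj => /=.
  by apply: omorphism_ext => y /=; rewrite SubK; exact: asboolb.
by rewrite SubK points_indicator.
Qed.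

End Flatness.

Theorem mainTheorem8 (d : Order.disp_t) (A : preorderType d) :
  (exists2 f : {omorphism Flat P1 A -> NonemptyDownset A},
     (forall M : Flat P1 A, val (f M) = [set x : A | val M x = true]) &
     preorder_iso f) /\
  (exists2 f : {omorphism Flat P2 A -> Alg A},
     (forall M : Flat P2 A, val (f M) = [set x : A | val M x = true]) &
     preorder_iso f).
Proof.
split.
  by apply: Flat_iso => [D []|M]; last exact: flat_P1P.
by apply: Flat_iso => [D []|M]; last exact: flat_P2P.
Qed.
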